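(* Let $\sigma\in(0,1)$ be any fixed constant. Then for each $\lambda\in(0,\lambda_\sigma]$, the function $H_{\lambda,\sigma}$ is a positive $C^2$ solution on $\mathbb{R}$ of the ODE $$(y'')^{+}-\sigma^{2}(y'')^{-}+xy'+2\lambda y=0.$$
   Context: For real $a$, $a^{+}=\max\{0,a\}$ and $a^{-}=(-a)^{+}$. For $\lambda\in(0,\frac12)$ and $x\in\mathbb{R}$, $$\varphi_\lambda(x):=\int_0^{+\infty}y^{-2\lambda}\exp\left\{-\frac{(y-x)^2}{2}\right\}dy ,$$ and primes denote derivatives in $x$. For each $\lambda\in(0,\frac12)$, $x_1^\lambda<0$ denotes the unique negative number with $\varphi_\lambda''(x_1^\lambda)=0$, $z^\lambda>0$ denotes the unique positive number with $\varphi_\lambda''(z^\lambda)+\varphi_\lambda''(-z^\lambda)=0$ (existence and uniqueness hold), and $\sigma_\lambda:=-x_1^\lambda/z^\lambda\in(0,1)$. The map $\lambda\mapsto\sigma_\lambda$ is a continuous strictly increasing bijection from $(0,\frac12)$ onto $(0,1)$; for $\sigma\in(0,1)$, $\lambda_\sigma\in(0,\frac12)$ denotes the unique constant with $\sigma_{\lambda_\sigma}=\sigma$. For $\lambda\in(0,\frac12)$ and $\sigma\in[\sigma_\lambda,1)$ (equivalently $\lambda\le\lambda_\sigma$), define $$H_{\lambda,\sigma}(x):=\begin{cases}\mu_1^\lambda\varphi_\lambda(x)+\mu_2^\lambda\varphi_\lambda(-x), & x\le-\sigma z^\lambda,\\ \varphi_\lambda\!\left(\frac{x}{\sigma}\right)+\varphi_\lambda\!\left(-\frac{x}{\sigma}\right),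 & -\sigma z^\lambda<x<\sigma z^\lambda,\\ \mu_2^\lambda\varphi_\lambda(x)+\mu_1^\lambda\varphi_\lambda(-x), & x\ge\sigma z^\lambda,\end{cases}$$ where $$\mu_1^{\lambda}=\frac{\varphi_\lambda''(\sigma z^\lambda)\,[\varphi_\lambda(-z^\lambda)+\varphi_\lambda(z^\lambda)]}{\varphi_\lambda(-\sigma z^\lambda)\varphi_\lambda''(\sigma z^\lambda)-\varphi_\lambda(\sigma z^\lambda)\varphi_\lambda''(-\sigma z^\lambda)},\qquad \mu_2^{\lambda}=\frac{\varphi_\lambda''(-\sigma z^\lambda)\,[\varphi_\lambda(-z^\lambda)+\varphi_\lambda(z^\lambda)]}{\varphi_\lambda(\sigma z^\lambda)\varphi_\lambda''(-\sigma z^\lambda)-\varphi_\lambda(-\sigma z^\lambda)\varphi_\lambda''(\sigma z^\lambda)}.$$ *)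

(* Defs.v *)
From Stdlib Require Import Reals.
From Coquelicot Require Import Coquelicot.
Open Scope R_scope.

Definition pos_part (a : R) : R := Rmax 0 a.
Definition neg_part (a : R) : R := pos_part (- a).

(* Improper at both ends: the integrand is singular at [0] since [lam > 0].
   Only values at [y > 0] matter, where [Rpower] is the real power. *)
Definition phi (lam x : R) : R :=
  RInt_gen (fun y => Rpower y (- (2 * lam)) * exp (- ((y - x) ^ 2 / 2)))
    (at_right 0) (Rbar_locally p_infty).

Definition phi'' (lam : R) : R -> R := Derive_n (phi lam) 2.

(* [iota P] is the unique real satisfying [P] when there is exactly one. *)
Definition x1 (lam : R) : R :=
  iota (fun x : R => x < 0 /\ phi'' lam x = 0).

Definition z (lam : R) : R :=
  iota (fun x : R => 0 < x /\ phi'' lam x + phi'' lam (- x) = 0).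

Definition sigma_ (lam : R) : R := - x1 lam / z lam.

Definition mu1 (lam sigma : R) : R :=
  let s := sigma * z lam in
  phi'' lam s * (phi lam (- z lam) + phi lam (z lam)) /
  (phi lam (- s) * phi'' lam s - phi lam s * phi'' lam (- s)).

Definition mu2 (lam sigma : R) : R :=
  let s := sigma * z lam in
  phi'' lam (- s) * (phi lam (- z lam) + phi lam (z lam)) /
  (phi lam s * phi'' lam (- s) - phi lam (- s) * phi'' lam s).

Definition H (lam sigma x : R) : R :=
  if Rle_dec x (- (sigma * z lam)) then
    mu1 lam sigma * phi lam x + mu2 lam sigma * phi lam (- x)
  else if Rlt_dec x (sigma * z lam) then
    phi lam (x / sigma) + phi lam (- (x / sigma))
  else
    mu2 lam sigma * phi lam x + mu1 lam sigma * phi lam (- x).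

(* [Derive] is total, so differentiability is required at every order up to 2:
   [ex_derive_n f 2] alone would not give differentiability of [f]. *)
Definition C2 (f : R -> R) : Prop :=
  (forall (k : nat) (x : R), (k <= 2)%nat -> ex_derive_n f k x) /\
  (forall x : R, continuous (Derive_n f 2) x).

(* Main.v *)
(* The function phi satisfies f'' + x f' + 2 lam f = 0, an equation invariant under
   x -> -x, and positive solutions of it change convexity in one direction only: on
   (0, oo), f''(t) >= 0 forces f'(t) < 0, which persists because
   (e^(x^2/2) f')' = - 2 lam e^(x^2/2) f < 0, and then
   (e^(x^2/2) f'')' = - (1 + 2 lam) e^(x^2/2) f' > 0 keeps f'' > 0.
   Applied to phi(-x) and to psi(x) = phi(x) + phi(-x) this gives existence and
   uniqueness of x1 and z; applied to the outer branch of H, whose second derivative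
   vanishes at sigma z, it gives the convexity there. At the junctions both second
   derivatives vanish, so the two equations equate the first derivatives as soon as
   the values agree.
   The inequality sigma_lam <= sigma follows from the monotonicity in lam of x1
   (Chebyshev's integral inequality for phi'/phi) and of z (a Wronskian-type
   quantity for psi). *)
Require Import Defs.
From Stdlib Require Import Reals Lra Lia Classical.
From Coquelicot Require Import Coquelicot.
Open Scope R_scope.

(** * Improper integrals on the half-line *)

Notation is_int f l := (is_RInt_gen f (at_right 0) (Rbar_locally p_infty) l).

(** Replaces the product filter by explicit thresholds for the two endpoints; eventual statements
    about pairs [(a, b)] are reduced to it. *)
Lemma ends_intro (P : R * R -> Prop) (a0 b0 : R) :
  0 < a0 -> (forall a b, 0 < a < a0 -> b0 < b -> P (a, b)) ->
  filter_prod (at_right 0) (Rbar_locally p_infty) P.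
Proof.
  intros ha h.
  apply Filter_prod with (fun a => 0 < a < a0) (fun b => b0 < b).
  - exists (mkposreal a0 ha). intros y hy hy0.
    unfold ball in hy; simpl in hy; unfold AbsRing_ball, abs, minus, plus, opp in hy; simpl in hy.
    apply Rabs_lt_between in hy. lra.
  - exists b0. auto.
  - exact h.
Qed.

Lemma is_int_ext (f g : R -> R) (l : R) :
  (forall y, 0 < y -> f y = g y) -> is_int f l -> is_int g l.
Proof.
  intros hfg. apply is_RInt_gen_ext.
  apply ends_intro with 1 1; [lra|]. simpl. intros a b ha hb y hy.
  apply hfg. rewrite Rmin_left in hy; lra.
Qed.

Lemma is_int_plus (f g : R -> R) (k l : R) :
  is_int f k -> is_int g l -> is_int (fun y => f y + g y) (k + l).
Proof. exact (is_RInt_gen_plus f g k l). Qed.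

Lemma is_int_scal (f : R -> R) (c l : R) :
  is_int f l -> is_int (fun y => c * f y) (c * l).
Proof. exact (is_RInt_gen_scal f c l). Qed.

Lemma is_int_ge0 (f : R -> R) (l : R) :
  (forall y, 0 < y -> 0 <= f y) -> is_int f l -> 0 <= l.
Proof.
  intros hf hl.
  assert (h0 : is_int (fun y => 0 * f y) (0 * l)) by now apply is_int_scal.
  (* Order comes from the norm inequality for improper integrals: the integrand [0 * f] is dominated
     in norm by [f], so the norm of its integral is at most [l]. *)
  replace 0 with (norm (0 * l)).
  2:{ rewrite Rmult_0_l. exact norm_zero. }
  refine (RInt_gen_norm _ f _ l _ _ h0 hl).
  - apply ends_intro with 1 1; [lra|]. simpl; intros; lra.
  - apply ends_intro with 1 1; [lra|]. simpl; intros a b ha hb y hy.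
    rewrite Rmult_0_l. apply Rle_trans with 0; [|apply hf; lra].
    right. exact (norm_zero (V := R_NormedModule)).
Qed.

Lemma is_int_le (f g : R -> R) (k l : R) :
  (forall y, 0 < y -> f y <= g y) -> is_int f k -> is_int g l -> k <= l.
Proof.
  intros hfg hk hl.
  assert (0 <= l + (-1) * k); [|lra].
  apply is_int_ge0 with (fun y => g y + (-1) * f y).
  - intros y hy. specialize (hfg y hy). lra.
  - apply is_int_plus; [exact hl|]. now apply is_int_scal.
Qed.

Lemma is_int_unique (f : R -> R) (k l : R) : is_int f k -> is_int f l -> k = l.
Proof.
  intros hk hl. apply Rle_antisym; [apply is_int_le with f f|apply is_int_le with f f];
    auto; intros; lra.
Qed.

(** Fundamental theorem of calculus on each [[a, b]], followed by passing to the limit in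
    [F b - F a] at both ends independently. *)
Lemma is_int_derive (F f : R -> R) (l0 l1 : R) :
  (forall y, 0 < y -> is_derive F y (f y)) -> (forall y, 0 < y -> continuous f y) ->
  filterlim F (at_right 0) (locally l0) -> filterlim F (Rbar_locally p_infty) (locally l1) ->
  is_int f (l1 - l0).
Proof.
  intros hF hf h0 h1.
  intros P hP.
  assert (hl : filterlim (fun ab => F (snd ab) - F (fst ab))
     (filter_prod (at_right 0) (Rbar_locally p_infty)) (locally (l1 - l0))).
  { apply (filterlim_comp_2 (F := filter_prod (at_right 0) (Rbar_locally p_infty))
      (fun ab => F (snd ab)) (fun ab => F (fst ab)) Rminus (G := locally l1) (H := locally l0)).
    - apply filterlim_comp with (2 := h1). apply filterlim_snd.
    - apply filterlim_comp with (2 := h0). apply filterlim_fst.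
    - unfold Rminus. apply (filterlim_comp_2 (F := filter_prod (locally l1) (locally l0))
       (fun ab => fst ab) (fun ab => - snd ab) Rplus (G := locally l1) (H := locally (- l0))).
      + apply filterlim_fst.
      + apply filterlim_comp with (1 := filterlim_snd). apply (filterlim_opp l0).
      + apply (filterlim_plus l1 (- l0)). }
  specialize (hl P hP). unfold filtermap in hl.
  assert (hle : filter_prod (at_right 0) (Rbar_locally p_infty)
    (fun ab => 0 < fst ab <= snd ab)).
  { apply ends_intro with 1 1; [lra|]. simpl; intros; lra. }
  unfold filtermapi. refine (filter_imp _ _ _ (filter_and _ _ hl hle)).
  intros [a b] [hp hab]. simpl in *.
  exists (F b - F a). split; [|exact hp].
  apply (is_RInt_derive F f); intros y hy; rewrite Rmin_left in hy by lra;
    [apply hF|apply hf]; lra.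
Qed.

(** Comparison test. The integrals of [f] over [[a, b]] grow with the interval and are at most
    [B b - B a <= K]; their supremum is the improper integral. It is positive because it is at least
    the integral over [[1, 2]]. *)
Lemma ex_int_pos (f g B : R -> R) (K : R) :
  (forall y, 0 < y -> continuous f y) -> (forall y, 0 < y -> 0 < f y <= g y) ->
  (forall y, 0 < y -> is_derive B y (g y)) -> (forall y, 0 < y -> continuous g y) ->
  (forall y, 0 < y -> 0 <= B y <= K) ->
  exists l, 0 < l /\ is_int f l.
Proof.
  intros cf hfg hB cg hK.
  assert (ef : forall a b, 0 < a -> 0 < b -> ex_RInt f a b).
  { intros a b ha hb. apply (ex_RInt_continuous (V := R_CompleteNormedModule)).
    intros y hy. apply cf. generalize (Rmin_glb_lt a b 0 ha hb); lra. }
  assert (mono : forall a a' b b', 0 < a <= a' -> a' <= b' -> b' <= b ->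
     RInt f a' b' <= RInt f a b).
  { intros a a' b b' h1 h2 h3.
    rewrite <- (RInt_Chasles f a a' b) by (apply ef; lra).
    rewrite <- (RInt_Chasles f a' b' b) by (apply ef; lra).
    unfold plus; simpl.
    assert (0 <= RInt f a a') by (apply RInt_ge_0; [lra|apply ef; lra|intros y hy; apply Rlt_le, hfg; lra]).
    assert (0 <= RInt f b' b) by (apply RInt_ge_0; [lra|apply ef; lra|intros y hy; apply Rlt_le, hfg; lra]).
    lra. }
  set (E := fun v => exists a b, 0 < a <= b /\ v = RInt f a b).
  destruct (completeness E) as [l [lub1 lub2]].
  { exists K. intros v (a & b & hab & ->).
    assert (hg : is_RInt g a b (B b - B a)).
    { apply (is_RInt_derive B g); intros y hy; rewrite Rmin_left in hy by lra;
      [apply hB|apply cg]; lra. }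
    apply Rle_trans with (B b - B a).
    - apply (is_RInt_le f g a b); [lra| |exact hg|].
      + apply (RInt_correct (V := R_CompleteNormedModule)). apply ef; lra.
      + intros y hy. apply hfg. lra.
    - generalize (hK a) (hK b). lra. }
  { exists (RInt f 1 2), 1, 2. split; [lra|reflexivity]. }
  exists l. split.
  - apply Rlt_le_trans with (RInt f 1 2).
    + apply RInt_gt_0; [lra| |].
      * intros y hy; apply hfg; lra.
      * intros y hy. apply cf; lra.
    + apply lub1. exists 1, 2. split; [lra|reflexivity].
  - intros P [eps hP].
    (* An interval nearly attaining the supremum supplies the thresholds; if there were none,
       [l - eps] would be a smaller upper bound. *)
    destruct (classic (exists a b, 0 < a <= b /\ l - eps < RInt f a b)) as [(a0 & b0 & h0 & h1)|hn].
    + apply ends_intro with a0 b0; [lra|]. intros a b ha hb. simpl.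
      exists (RInt f a b). split.
      * apply (RInt_correct (V := R_CompleteNormedModule)). apply ef; lra.
      * apply hP. apply Rabs_lt_between'. split.
        -- apply Rlt_le_trans with (1 := h1). apply mono; lra.
        -- apply Rle_lt_trans with l; [|generalize (cond_pos eps); lra].
           apply lub1. exists a, b. split; [lra|reflexivity].
    + exfalso. assert (l <= l - eps); [|generalize (cond_pos eps); lra].
      apply lub2. intros v (a & b & hab & ->). apply Rnot_lt_le. intros h. apply hn.
      exists a, b. auto.
Qed.

(** * The kernels y^a e^(xy - y^2/2) *)

(** For [a = - 2 lam], the integrand of [phi] without the factor [e^(-x^2/2)]. As a single
    exponential, a change of [a] or [x] is just multiplication by another exponential. *)
Definition kern (a x y : R) : R := exp (a * ln y + x * y - y ^ 2 / 2).

Lemma kern_pos (a x y : R) : 0 < kern a x y.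
Proof. apply exp_pos. Qed.

Lemma kern_succ (a x y : R) : 0 < y -> kern (a + 1) x y = y * kern a x y.
Proof.
  intros hy. unfold kern. rewrite <- (exp_ln y) at 4 by assumption.
  rewrite <- exp_plus. f_equal. ring.
Qed.

Lemma kern_continuous (a x y : R) : 0 < y -> continuous (kern a x) y.
Proof.
  intros hy. apply (ex_derive_continuous (V := R_NormedModule)).
  unfold kern. auto_derive. exact hy.
Qed.

Lemma ln_lt_self (y : R) : 0 < y -> ln y < y.
Proof.
  intros hy. apply exp_lt_inv. rewrite exp_ln by assumption.
  generalize (exp_ineq1 y). lra.
Qed.

Lemma exp_gauss_bound (c y : R) : exp (c * y - y ^ 2 / 2) <= exp (c ^ 2 / 2).
Proof.
  destruct (Rle_lt_or_eq_dec (c * y - y ^ 2 / 2) (c ^ 2 / 2)) as [h|h].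
  - generalize (pow2_ge_0 (c - y)). lra.
  - apply Rlt_le, exp_increasing, h.
  - rewrite h. lra.
Qed.

(** The last factor is the derivative of [1 - 1 / (1 + y^p)], which stays in [[0, 1]], so one
    majorant serves both ends: it behaves like [y^(p-1)] at 0 and like [y^(-p-1)] at infinity. The
    cost is [(1 + y^p)^2 <= 4 e^(2py)], absorbed by the Gaussian after completing the square. *)
Lemma kern_bound (p x y : R) : 0 < p -> 0 < y ->
  kern (p - 1) x y <=
  4 / p * exp ((x + 2 * p) ^ 2 / 2) *
  (p * exp (p * ln y) / y / (1 + exp (p * ln y)) ^ 2).
Proof.
  intros hp hy.
  assert (h1 : exp (p * ln y) <= exp (p * y)).
  { apply Rlt_le, exp_increasing, Rmult_lt_compat_l; [exact hp|]. now apply ln_lt_self. }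
  assert (h2 : 1 <= exp (p * y)).
  { rewrite <- exp_0. apply Rlt_le, exp_increasing. now apply Rmult_lt_0_compat. }
  assert (h3 := exp_gauss_bound (x + 2 * p) y).
  assert (h4 : exp ((x + 2 * p) * y - y ^ 2 / 2)
     = exp (x * y - y ^ 2 / 2) * (exp (p * y)) ^ 2).
  { replace (exp (p * y) ^ 2) with (exp (p * y) * exp (p * y)) by ring.
    rewrite <- !exp_plus. f_equal. field. }
  rewrite h4 in h3.
  replace (kern (p - 1) x y) with (exp (p * ln y) / y * exp (x * y - y ^ 2 / 2)).
  2:{ replace (exp (p * ln y) / y) with (exp (p * ln y) * exp (- ln y))
        by (rewrite exp_Ropp, exp_ln by assumption; reflexivity).
      unfold kern. rewrite <- !exp_plus. f_equal. field. }
  generalize (exp_pos (p * ln y)) (exp_pos (x * y - y ^ 2 / 2)).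
  set (Y := exp (p * ln y)) in *. set (W := exp (p * y)) in *.
  set (E := exp (x * y - y ^ 2 / 2)) in *. set (C := exp ((x + 2 * p) ^ 2 / 2)) in *.
  intros hY hE.
  replace (4 / p * C * (p * Y / y / (1 + Y) ^ 2)) with (Y / y * (4 * C / (1 + Y) ^ 2))
    by (field; repeat split; lra).
  apply Rmult_le_compat_l.
  { apply Rlt_le, Rdiv_lt_0_compat; assumption. }
  apply Rle_div_r. { apply pow_lt; lra. }
  apply Rle_trans with (E * (2 * W) ^ 2); [|lra].
  apply Rmult_le_compat_l; [lra|]. apply pow_incr. lra.
Qed.

Lemma kern_int (a x : R) : -1 < a -> exists l, 0 < l /\ is_int (kern a x) l.
Proof.
  intros ha. set (p := a + 1). assert (hp : 0 < p) by (unfold p; lra).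
  replace a with (p - 1) by (unfold p; ring).
  set (K := 4 / p * exp ((x + 2 * p) ^ 2 / 2)).
  assert (hK : 0 < K).
  { apply Rmult_lt_0_compat; [|apply exp_pos]. apply Rdiv_lt_0_compat; lra. }
  apply ex_int_pos with
    (fun y => K * (p * exp (p * ln y) / y / (1 + exp (p * ln y)) ^ 2))
    (fun y => K * (1 - / (1 + exp (p * ln y)))) K; intros y hy.
  - now apply kern_continuous.
  - split; [apply kern_pos|]. now apply kern_bound.
  - assert (h := exp_pos (p * ln y)).
    auto_derive; [repeat split; lra|]. field. split; lra.
  - assert (h := exp_pos (p * ln y)).
    apply (ex_derive_continuous (V := R_NormedModule)). auto_derive.
    repeat split; try lra. apply Rgt_not_eq. nra.
  - assert (h := exp_pos (p * ln y)).
    assert (h1 : 0 < / (1 + exp (p * ln y))) by (apply Rinv_0_lt_compat; lra).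
    assert (h2 : / (1 + exp (p * ln y)) <= 1).
    { rewrite <- Rinv_1. apply Rinv_le_contravar; lra. }
    split; [apply Rmult_le_pos; lra|]. nra.
Qed.

(** * Integrals of the kernels: recurrence in [a], derivative in [x], comparison of ratios *)

Definition G (a x : R) : R := RInt_gen (kern a x) (at_right 0) (Rbar_locally p_infty).

Lemma G_int (a x : R) : -1 < a -> is_int (kern a x) (G a x).
Proof.
  intros ha. destruct (kern_int a x ha) as (l & _ & hl).
  apply (RInt_gen_correct (V := R_CompleteNormedModule)). now exists l.
Qed.

Lemma G_pos (a x : R) : -1 < a -> 0 < G a x.
Proof.
  intros ha. destruct (kern_int a x ha) as (l & h & hl).
  now rewrite <- (is_int_unique _ _ _ hl (G_int a x ha)).
Qed.

Lemma kern_lim_0 (p x : R) : 0 < p -> filterlim (kern p x) (at_right 0) (locally 0).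
Proof.
  intros hp. apply (filterlim_comp _ _ _ (fun y => p * ln y + x * y - y ^ 2 / 2) exp
    _ (Rbar_locally m_infty)); [|exact is_lim_exp_m].
  intros P [M hM].
  (* Below 1, [x * y <= |x|]; below the second bound, [p * ln y < M - |x|]. Together the exponent is
     less than [M]. *)
  set (d := Rmin 1 (exp ((M - Rabs x) / p))).
  assert (hd : 0 < d) by (apply Rmin_glb_lt; [lra|apply exp_pos]).
  exists (mkposreal d hd). intros y hy hy0. apply hM.
  unfold ball in hy; simpl in hy; unfold AbsRing_ball, abs, minus, plus, opp in hy; simpl in hy.
  apply Rabs_lt_between in hy.
  assert (h1 : y < 1) by (generalize (Rmin_l 1 (exp ((M - Rabs x) / p))); fold d; lra).
  assert (h2 : y < exp ((M - Rabs x) / p))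
    by (generalize (Rmin_r 1 (exp ((M - Rabs x) / p))); fold d; lra).
  apply ln_increasing in h2; [|exact hy0]. rewrite ln_exp in h2.
  apply Rlt_div_r in h2; [|exact hp].
  assert (h3 : x * y <= Rabs x).
  { generalize (Rle_abs x) (Rabs_pos x). nra. }
  generalize (pow2_ge_0 y). lra.
Qed.

Lemma kern_lim_infty (p x : R) : 0 < p -> filterlim (kern p x) (Rbar_locally p_infty) (locally 0).
Proof.
  intros hp. apply (filterlim_comp _ _ _ (fun y => p * ln y + x * y - y ^ 2 / 2) exp
    _ (Rbar_locally m_infty)); [|exact is_lim_exp_m].
  intros P [M hM].
  (* By [ln y < y] the exponent is below [(p + x + 1) y - y^2/2 - y], hence below
     [(p + x + 1)^2 / 2 - y]. *)
  exists (Rmax 0 ((p + x + 1) ^ 2 / 2 - M)). intros y hy. apply hM.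
  assert (h1 : 0 < y) by (eapply Rle_lt_trans; [apply Rmax_l|exact hy]).
  assert (h2 : (p + x + 1) ^ 2 / 2 - M < y) by (eapply Rle_lt_trans; [apply Rmax_r|exact hy]).
  assert (h3 := ln_lt_self y h1). generalize (pow2_ge_0 (p + x + 1 - y)). nra.
Qed.

(** Integration by parts: the derivative in [y] of [kern (a + 1) x] integrates to 0, since this
    kernel vanishes at both ends when [a + 1 > 0]. *)
Lemma G_rec (a x : R) : -1 < a -> G (a + 1 + 1) x = x * G (a + 1) x + (a + 1) * G a x.
Proof.
  intros ha.
  assert (h : is_int (fun y => (a + 1) * kern a x y + (x * kern (a + 1) x y + -1 * kern (a + 1 + 1) x y))
            (0 - 0)).
  { apply is_int_derive with (kern (a + 1) x).
    - intros y hy. rewrite !kern_succ by assumption.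
      unfold kern. auto_derive; [exact hy|].
      replace (exp ((a + 1) * ln y + x * y + - (y * (y * 1) * / 2))) with (kern (a + 1) x y)
        by (unfold kern; f_equal; field).
      rewrite kern_succ by assumption. unfold kern. field. lra.
    - intros y hy. apply (ex_derive_continuous (V := R_NormedModule)).
      unfold kern. auto_derive. repeat split; exact hy.
    - apply kern_lim_0; lra.
    - apply kern_lim_infty; lra. }
  assert (h' : is_int (fun y => (a + 1) * kern a x y + (x * kern (a + 1) x y + -1 * kern (a + 1 + 1) x y))
    ((a + 1) * G a x + (x * G (a + 1) x + -1 * G (a + 1 + 1) x))).
  { apply is_int_plus; [|apply is_int_plus]; apply is_int_scal, G_int; lra. }
  generalize (is_int_unique _ _ _ h h'). lra.
Qed.

Lemma exp_remainder (u : R) : 0 <= exp u - 1 - u <= u ^ 2 * exp (Rabs u).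
Proof.
  assert (h1 := exp_ineq1_le u). assert (h2 := exp_ineq1_le (- u)).
  assert (h3 := exp_pos u).
  assert (h4 : exp u * exp (- u) = 1).
  { rewrite <- exp_plus, Rplus_opp_r. apply exp_0. }
  assert (h5 : exp u - 1 <= u * exp u) by nra.
  split; [lra|].
  destruct (Rle_lt_dec 0 u) as [hu|hu].
  - rewrite Rabs_pos_eq by assumption. nra.
  - rewrite Rabs_left by assumption. assert (1 <= exp (- u)) by lra. nra.
Qed.

(** Differentiation under the integral by a direct second-order estimate. For [|h| <= 1] the Taylor
    remainder of [e^(hy)] is at most [h^2 y^2 e^y], and multiplying the kernel by [y^2 e^y] gives
    [kern (a + 1 + 1) (x + 1)], which is integrable. *)
Lemma G_derive (a x : R) : -1 < a -> is_derive (G a) x (G (a + 1) x).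
Proof.
  intros ha.
  assert (key : forall h, Rabs h <= 1 ->
    Rabs (G a (x + h) - G a x - h * G (a + 1) x) <= h ^ 2 * G (a + 1 + 1) (x + 1)).
  { intros h hh.
    assert (hd : is_int (fun y => kern a (x + h) y + (-1 * kern a x y + - h * kern (a + 1) x y))
       (G a (x + h) + (-1 * G a x + - h * G (a + 1) x))).
    { apply is_int_plus; [apply G_int; lra|].
      apply is_int_plus; apply is_int_scal, G_int; lra. }
    assert (hb : is_int (fun y => h ^ 2 * kern (a + 1 + 1) (x + 1) y)
       (h ^ 2 * G (a + 1 + 1) (x + 1))) by (apply is_int_scal, G_int; lra).
    assert (pt : forall y, 0 < y ->
       0 <= kern a (x + h) y + (-1 * kern a x y + - h * kern (a + 1) x y)
         <= h ^ 2 * kern (a + 1 + 1) (x + 1) y).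
    { intros y hy. rewrite !kern_succ by assumption.
      assert (e1 : forall s, kern a (x + s) y = kern a x y * exp (s * y)).
      { intros s. unfold kern. rewrite <- exp_plus. f_equal. ring. }
      rewrite !e1, Rmult_1_l.
      assert (h2 := exp_remainder (h * y)). assert (h0 := kern_pos a x y).
      assert (h3 : exp (Rabs (h * y)) <= exp y).
      { rewrite Rabs_mult, (Rabs_pos_eq y) by lra.
        destruct (Rle_lt_or_eq_dec (Rabs h * y) y) as [h3|h3]; [nra| |].
        - apply Rlt_le, exp_increasing, h3.
        - rewrite h3; lra. }
      assert (h4 : exp (h * y) - 1 - h * y <= (h * y) ^ 2 * exp y).
      { apply Rle_trans with (1 := proj2 h2). apply Rmult_le_compat_l; [apply pow2_ge_0|exact h3]. }
      replace (kern a x y * exp (h * y) + (-1 * kern a x y + - h * (y * kern a x y)))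
        with (kern a x y * (exp (h * y) - 1 - h * y)) by ring.
      replace (h ^ 2 * (y * (y * (kern a x y * exp y))))
        with (kern a x y * ((h * y) ^ 2 * exp y)) by ring.
      split; [apply Rmult_le_pos; lra|apply Rmult_le_compat_l; lra]. }
    assert (l1 := is_int_ge0 _ _ (fun y hy => proj1 (pt y hy)) hd).
    assert (l2 := is_int_le _ _ _ _ (fun y hy => proj2 (pt y hy)) hd hb).
    rewrite Rabs_pos_eq; lra. }
  apply is_derive_Reals. intros eps heps.
  assert (hG : 0 < G (a + 1 + 1) (x + 1)) by (apply G_pos; lra).
  assert (hdel : 0 < Rmin 1 (eps / G (a + 1 + 1) (x + 1))).
  { apply Rmin_glb_lt; [lra|]. now apply Rdiv_lt_0_compat. }
  exists (mkposreal _ hdel). simpl. intros h h0 hh.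
  assert (h1 : Rabs h < 1) by (eapply Rlt_le_trans; [exact hh|apply Rmin_l]).
  assert (h2 : Rabs h < eps / G (a + 1 + 1) (x + 1))
    by (eapply Rlt_le_trans; [exact hh|apply Rmin_r]).
  apply Rlt_div_r in h2; [|exact hG].
  assert (h3 : 0 < Rabs h) by now apply Rabs_pos_lt.
  replace ((G a (x + h) - G a x) / h - G (a + 1) x)
    with ((G a (x + h) - G a x - h * G (a + 1) x) / h) by (field; exact h0).
  rewrite Rabs_div by exact h0. apply Rlt_div_l; [exact h3|].
  apply Rle_lt_trans with (1 := key h (Rlt_le _ _ h1)).
  rewrite <- pow2_abs. nra.
Qed.

(* Chebyshev's inequality: the additional decreasing weight [y ^ (b - a)] lowers the
   mean [c] of [y] under the kernel [kern a x]. *)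
Lemma G_ratio_mono (a b x : R) : -1 < b <= a ->
  G (b + 1) x * G a x <= G (a + 1) x * G b x.
Proof.
  intros [hb hab].
  assert (pa : 0 < G a x) by (apply G_pos; lra).
  assert (pa1 : 0 < G (a + 1) x) by (apply G_pos; lra).
  set (c := G (a + 1) x / G a x).
  assert (hc : 0 < c) by now apply Rdiv_lt_0_compat.
  assert (ec : G (a + 1) x = c * G a x) by (unfold c; field; lra).
  (* [t] is the weight at the mean [c]. Then [(y - c)] times (weight minus [t]) is never positive,
     and the term with [t] integrates to 0 because [c] is the mean. *)
  set (t := exp ((b - a) * ln c)).
  assert (hi : is_int (fun y => (kern (b + 1) x y + - c * kern b x y)
       + - t * (kern (a + 1) x y + - c * kern a x y))
     ((G (b + 1) x + - c * G b x) + - t * (G (a + 1) x + - c * G a x))).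
  { apply is_int_plus; [|apply is_int_scal];
      (apply is_int_plus; [|apply is_int_scal]; apply G_int; lra). }
  assert (h0 : is_int (fun y => 0 * kern a x y) (0 * G a x)) by (apply is_int_scal, G_int; lra).
  assert (hle : (G (b + 1) x + - c * G b x) + - t * (G (a + 1) x + - c * G a x) <= 0 * G a x).
  { refine (is_int_le _ _ _ _ _ hi h0). intros y hy.
    rewrite !kern_succ by assumption.
    assert (e : kern b x y = exp ((b - a) * ln y) * kern a x y).
    { unfold kern. rewrite <- exp_plus. f_equal. ring. }
    rewrite e.
    replace (y * (exp ((b - a) * ln y) * kern a x y) + - c * (exp ((b - a) * ln y) * kern a x y) +
      - t * (y * kern a x y + - c * kern a x y))
      with (kern a x y * ((y - c) * (exp ((b - a) * ln y) - t))) by ring.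
    rewrite Rmult_0_l.
    assert (hk := kern_pos a x y).
    assert (exple : forall u v, u <= v -> exp u <= exp v).
    { intros u v [h| ->]; [apply Rlt_le, exp_increasing, h|lra]. }
    assert ((y - c) * (exp ((b - a) * ln y) - t) <= 0); [|nra].
    destruct (Rle_lt_dec y c) as [h|h].
    - assert (ln y <= ln c) by now apply ln_le.
      assert (t <= exp ((b - a) * ln y)) by (apply exple; nra). nra.
    - assert (ln c <= ln y) by (apply ln_le; lra).
      assert (exp ((b - a) * ln y) <= t) by (apply exple; nra). nra. }
  rewrite ec in hle |- *. nra.
Qed.

(** * Solutions of the linear equation *)

(* In the eta-expanded form that [auto_derive] leaves. *)
Lemma Derive_eta (f : R -> R) (x l : R) : is_derive f x l -> Derive (fun y : R => f y) x = l.
Proof. exact (is_derive_unique f x l). Qed.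

Lemma increasing_of_deriv_pos (f df : R -> R) (a b : R) :
  a < b -> (forall x, a <= x <= b -> is_derive f x (df x)) ->
  (forall x, a < x < b -> 0 < df x) -> f a < f b.
Proof.
  intros hab hd hp.
  destruct (MVT_cor2 f df a b hab) as (c & e & hc).
  { intros x hx. apply is_derive_Reals. now apply hd. }
  specialize (hp c hc). nra.
Qed.

(** [e^(x^2/2)] is the integrating factor of [f' + x f]; it cancels the term [- x f] in each
    first-order relation below. *)
Lemma is_derive_gauss_mul (f : R -> R) (x l : R) :
  is_derive f x l -> is_derive (fun x => exp (x ^ 2 / 2) * f x) x (exp (x ^ 2 / 2) * (x * f x + l)).
Proof.
  intros h. auto_derive; [now exists l|].
  rewrite (Derive_eta _ _ _ h). simpl. unfold Rdiv. field.
Qed.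

(* The value that [f'' + x f' + 2 lam f = 0] prescribes for [f'']. *)
Definition second (lam : R) (f f1 : R -> R) (x : R) : R := - x * f1 x - 2 * lam * f x.

(** The equation as a first-order system, with the derivative carried as explicit data [f1] rather
    than through the total operator [Derive]. *)
Definition solves (lam : R) (f f1 : R -> R) : Prop :=
  forall x, is_derive f x (f1 x) /\ is_derive f1 x (second lam f f1 x).

Lemma second_derive (lam : R) (f f1 : R -> R) (x : R) : solves lam f f1 ->
  is_derive (second lam f f1) x (- x * second lam f f1 x - (1 + 2 * lam) * f1 x).
Proof.
  intros hs. destruct (hs x) as [h1 h2]. unfold second.
  auto_derive; [repeat split; eexists; eassumption|].
  rewrite (Derive_eta _ _ _ h1), (Derive_eta _ _ _ h2).
  unfold second. ring.
Qed.

Lemma solves_comb (lam c d : R) (f f1 g g1 : R -> R) : solves lam f f1 -> solves lam g g1 ->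
  solves lam (fun x => c * f x + d * g x) (fun x => c * f1 x + d * g1 x).
Proof.
  intros hf hg x. destruct (hf x) as [f_1 f_2], (hg x) as [g_1 g_2]. unfold second in *.
  split; (auto_derive; [repeat split; eexists; eassumption|]).
  - rewrite (Derive_eta _ _ _ f_1), (Derive_eta _ _ _ g_1). ring.
  - rewrite (Derive_eta _ _ _ f_2), (Derive_eta _ _ _ g_2). ring.
Qed.

Lemma solves_opp (lam : R) (f f1 : R -> R) : solves lam f f1 ->
  solves lam (fun x => f (- x)) (fun x => - f1 (- x)).
Proof.
  intros hf x. destruct (hf (- x)) as [f_1 f_2]. unfold second in *.
  split; (auto_derive; [repeat split; eexists; eassumption|]).
  - rewrite (Derive_eta _ _ _ f_1). ring.
  - rewrite (Derive_eta _ _ _ f_2). ring.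
Qed.

Lemma first_neg (lam : R) (f f1 : R -> R) (t : R) : 0 < lam -> solves lam f f1 ->
  (forall x, t <= x -> 0 < f x) -> f1 t <= 0 -> forall x, t < x -> f1 x < 0.
Proof.
  intros hl hs hf ht x hx.
  assert (h : - (exp (t ^ 2 / 2) * f1 t) < - (exp (x ^ 2 / 2) * f1 x)).
  { apply (increasing_of_deriv_pos (fun x => - (exp (x ^ 2 / 2) * f1 x))
      (fun x => - (exp (x ^ 2 / 2) * (x * f1 x + second lam f f1 x)))); [exact hx| |].
    - intros y _. apply (is_derive_opp (V := R_NormedModule)).
      apply is_derive_gauss_mul, hs.
    - intros y hy. unfold second.
      assert (0 < exp (y ^ 2 / 2) * (lam * f y)); [|lra].
      apply Rmult_lt_0_compat; [apply exp_pos|]. apply Rmult_lt_0_compat; [exact hl|apply hf; lra]. }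
  generalize (exp_pos (x ^ 2 / 2)) (exp_pos (t ^ 2 / 2)). nra.
Qed.

Lemma second_pos (lam : R) (f f1 : R -> R) (t : R) : 0 < lam -> solves lam f f1 ->
  0 < t -> (forall x, t <= x -> 0 < f x) -> 0 <= second lam f f1 t ->
  forall x, t < x -> 0 < second lam f f1 x.
Proof.
  intros hl hs t0 hf ht x hx.
  (* From [f''(t) >= 0] the equation gives [t f'(t) <= - 2 lam f(t) < 0]. *)
  assert (h1 : f1 t < 0).
  { unfold second in ht. assert (0 < f t) by (apply hf; lra). nra. }
  assert (h : exp (t ^ 2 / 2) * second lam f f1 t < exp (x ^ 2 / 2) * second lam f f1 x).
  { apply (increasing_of_deriv_pos (fun x => exp (x ^ 2 / 2) * second lam f f1 x)
      (fun x => exp (x ^ 2 / 2) * (x * second lam f f1 x +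
         (- x * second lam f f1 x - (1 + 2 * lam) * f1 x)))); [exact hx| |].
    - intros y _. apply is_derive_gauss_mul, second_derive, hs.
    - intros y hy.
      assert (f1 y < 0) by (apply (first_neg lam f f1 t); trivial; lra).
      assert (0 < exp (y ^ 2 / 2) * ((1 + 2 * lam) * - f1 y)); [|lra].
      apply Rmult_lt_0_compat; [apply exp_pos|]. apply Rmult_lt_0_compat; lra. }
  generalize (exp_pos (x ^ 2 / 2)) (exp_pos (t ^ 2 / 2)). nra.
Qed.

(** At 0 the second derivative is [- 2 lam f(0) < 0]. It cannot stay negative, since a decreasing
    concave function does not remain positive; so it has a zero, and [second_pos] makes the sign
    change there the only one. *)
Lemma inflection (lam : R) (f f1 : R -> R) : 0 < lam -> solves lam f f1 ->
  (forall x, 0 <= x -> 0 < f x) -> f1 0 <= 0 ->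
  exists t, 0 < t /\ second lam f f1 t = 0 /\
    (forall x, 0 < x < t -> second lam f f1 x < 0) /\
    (forall x, t < x -> 0 < second lam f f1 x).
Proof.
  intros hl hs hf h0.
  assert (s0 : second lam f f1 0 < 0).
  { unfold second. generalize (hf 0 (Rle_refl 0)). nra. }
  assert (ex : exists b, 0 < b /\ 0 <= second lam f f1 b).
  { apply NNPP. intros hn.
    assert (hneg : forall x, 0 < x -> second lam f f1 x < 0).
    { intros x hx. apply Rnot_le_lt. intros h. apply hn. now exists x. }
    assert (f11 : f1 1 < 0) by (apply (first_neg lam f f1 0); trivial; lra).
    (* The point where the tangent at 1 meets the axis; by concavity [f] lies below its tangent, so
       [f b < 0]. *)
    set (b := 1 + f 1 / - f1 1).
    assert (hb : 1 < b).
    { assert (0 < f 1 / - f1 1); [|unfold b; lra].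
      apply Rdiv_lt_0_compat; [apply hf|]; lra. }
    assert (hle : - f 1 - f1 1 * (1 - 1) < - f b - f1 1 * (1 - b)).
    { apply (increasing_of_deriv_pos (fun x => - f x - f1 1 * (1 - x))
        (fun x => - f1 x + f1 1)); [exact hb| |].
      - intros y _. auto_derive; [exists (f1 y); apply hs|].
        rewrite (Derive_eta _ _ _ (proj1 (hs y))). ring.
      - intros y hy. assert (- f1 1 < - f1 y); [|lra].
        apply (increasing_of_deriv_pos (fun x => - f1 x) (fun x => - second lam f f1 x)); [lra| |].
        + intros w _. apply (is_derive_opp (V := R_NormedModule)), hs.
        + intros w hw. assert (second lam f f1 w < 0) by (apply hneg; lra). lra. }
    assert (hfb : 0 < f b) by (apply hf; lra).
    assert (e : f1 1 * (1 - b) = f 1) by (unfold b; field; lra).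
    lra. }
  destruct ex as (b & hb & sb).
  assert (hc : continuity (second lam f f1)).
  { intros x. apply derivable_continuous_pt. apply ex_derive_Reals_0. eexists.
    now apply second_derive. }
  destruct (IVT_cor (second lam f f1) 0 b hc) as (t & ht & et); [lra|nra|].
  assert (t0 : 0 < t).
  { destruct (Req_dec t 0) as [e|e]; [|lra]. rewrite e in et. lra. }
  exists t. repeat split; try assumption.
  - intros x hx. apply Rnot_le_lt. intros h.
    assert (0 < second lam f f1 t); [|lra].
    apply second_pos with x; trivial; try lra. intros; apply hf; lra.
  - apply second_pos; trivial; try lra. intros; apply hf; lra.
Qed.

(* The Wronskian-type quantity [Q = lam g' f - mu f' g] satisfies
   [Q' = - x Q - (mu - lam) f' g'], so [e^(x^2/2) Q] is nonincreasing. *)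
Lemma log_derivative_mono (lam mu t : R) (f f1 g g1 : R -> R) :
  0 < lam <= mu -> solves lam f f1 -> solves mu g g1 ->
  (forall x, 0 <= x -> 0 < f x) -> (forall x, 0 <= x -> 0 < g x) ->
  f1 0 = 0 -> g1 0 = 0 -> 0 < t ->
  lam * (g1 t * f t) <= mu * (f1 t * g t).
Proof.
  intros hl hf hg pf pg f0 g0 ht.
  set (Q := fun x => lam * (g1 x * f x) - mu * (f1 x * g x)).
  assert (hQ : forall x, is_derive Q x (- x * Q x - (mu - lam) * (f1 x * g1 x))).
  { intros x. unfold Q.
    destruct (hf x) as [f_1 f_2], (hg x) as [g_1 g_2]. unfold second in *.
    auto_derive; [repeat split; eexists; eassumption|].
    rewrite (Derive_eta _ _ _ f_1), (Derive_eta _ _ _ g_1).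
    rewrite (Derive_eta _ _ _ f_2), (Derive_eta _ _ _ g_2).
    ring. }
  destruct (MVT_cor2 (fun x => exp (x ^ 2 / 2) * Q x)
    (fun x => exp (x ^ 2 / 2) * (x * Q x + (- x * Q x - (mu - lam) * (f1 x * g1 x)))) 0 t ht)
    as (c & e & hc).
  { intros x _. apply is_derive_Reals. apply is_derive_gauss_mul, hQ. }
  assert (f1 c < 0) by (apply (first_neg lam f f1 0); trivial; lra).
  assert (g1 c < 0) by (apply (first_neg mu g g1 0); trivial; lra).
  assert (Q0 : Q 0 = 0) by (unfold Q; rewrite f0, g0; ring).
  rewrite Q0 in e.
  assert (0 <= (mu - lam) * (f1 c * g1 c)) by (apply Rmult_le_pos; nra).
  assert (h : exp (t ^ 2 / 2) * Q t <= 0).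
  { assert (0 <= exp (c ^ 2 / 2) * ((mu - lam) * (f1 c * g1 c)) * t); [|lra].
    apply Rmult_le_pos; [|lra]. apply Rmult_le_pos; [apply Rlt_le, exp_pos|assumption]. }
  assert (Q t <= 0) by (generalize (exp_pos (t ^ 2 / 2)); nra).
  unfold Q in *. lra.
Qed.

(** * The functions phi and psi *)

(** The derivative of [phi lam], by the product rule on [e^(-x^2/2) G(-2 lam, x)]. *)
Definition phi1 (lam x : R) : R :=
  exp (- (x ^ 2 / 2)) * (G (- (2 * lam) + 1) x - x * G (- (2 * lam)) x).

Lemma phi_G (lam x : R) : lam < 1 / 2 ->
  phi lam x = exp (- (x ^ 2 / 2)) * G (- (2 * lam)) x.
Proof.
  intros hl. unfold phi.
  apply (is_RInt_gen_unique (V := R_CompleteNormedModule)).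
  apply is_int_ext with (fun y => exp (- (x ^ 2 / 2)) * kern (- (2 * lam)) x y).
  - intros y hy. unfold kern, Rpower. rewrite <- !exp_plus. f_equal. field.
  - apply is_int_scal, G_int. lra.
Qed.

Lemma phi_pos (lam x : R) : lam < 1 / 2 -> 0 < phi lam x.
Proof.
  intros hl. rewrite phi_G by exact hl. apply Rmult_lt_0_compat; [apply exp_pos|].
  apply G_pos; lra.
Qed.

(** Differentiating [phi1] brings in [G (a + 1 + 1)] with [a = - 2 lam]; [G_rec] eliminates it and
    what remains beyond [- x phi'] is [a] times [phi]. *)
Lemma phi_solves (lam : R) : lam < 1 / 2 -> solves lam (phi lam) (phi1 lam).
Proof.
  intros hl x. set (a := - (2 * lam)).
  assert (ha : -1 < a) by (unfold a; lra).
  assert (d0 := G_derive a x ha).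
  assert (d1 := G_derive (a + 1) x ltac:(lra)).
  split.
  - apply is_derive_ext with (fun x => exp (- (x ^ 2 / 2)) * G a x).
    { intros y. symmetry. now apply phi_G. }
    auto_derive; [eexists; eassumption|].
    rewrite (Derive_eta _ _ _ d0). unfold phi1. fold a.
    replace (- (x * (x * 1) * / 2)) with (- (x ^ 2 / 2)) by field. field.
  - unfold second. rewrite phi_G by assumption. unfold phi1. fold a.
    auto_derive; [repeat split; eexists; eassumption|].
    rewrite (Derive_eta _ _ _ d0),
      (Derive_eta _ _ _ d1), (G_rec a x ha).
    replace (- (x * (x * 1) * / 2)) with (- (x ^ 2 / 2)) by field.
    unfold a. field.
Qed.

Lemma Derive_2 (f f1 f2 : R -> R) (x : R) :
  (forall x, is_derive f x (f1 x)) -> (forall x, is_derive f1 x (f2 x)) ->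
  Derive_n f 2 x = f2 x.
Proof.
  intros h1 h2. simpl. rewrite (Derive_ext _ f1).
  - apply is_derive_unique, h2.
  - intros y. apply is_derive_unique, h1.
Qed.

Lemma phi''_second (lam x : R) : lam < 1 / 2 ->
  phi'' lam x = second lam (phi lam) (phi1 lam) x.
Proof.
  intros hl. apply Derive_2 with (phi1 lam); intros y; now apply phi_solves.
Qed.

Lemma iota_spec (P : R -> Prop) (t : R) : P t -> (forall x, P x -> x = t) -> iota P = t.
Proof. intros ht hu. now apply (iota_unique (V := R_CompleteNormedModule)). Qed.

(** [inflection] is applied to the reflection [phi(-x)], whose derivative at 0 is [- phi'(0) < 0].
    Its sign pattern gives the existence and uniqueness that determine the value of [iota]. *)
Lemma x1_spec (lam : R) : 0 < lam < 1 / 2 ->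
  x1 lam < 0 /\ phi'' lam (x1 lam) = 0 /\
  (forall x, x < x1 lam -> 0 < phi'' lam x) /\
  (forall x, x1 lam < x < 0 -> phi'' lam x < 0).
Proof.
  intros [l0 l1].
  set (g := fun x => phi lam (- x)). set (g1 := fun x => - phi1 lam (- x)).
  assert (e : forall x, phi'' lam x = second lam g g1 (- x)).
  { intros x. rewrite phi''_second by exact l1. unfold second, g, g1.
    rewrite !Ropp_involutive. ring. }
  destruct (inflection lam g g1) as (t & t0 & ht & hlt & hgt).
  - exact l0.
  - now apply solves_opp, phi_solves.
  - intros x _. unfold g. apply phi_pos. exact l1.
  - unfold g1, phi1. rewrite Ropp_0.
    assert (0 < exp (- (0 ^ 2 / 2)) * G (- (2 * lam) + 1) 0).
    { apply Rmult_lt_0_compat; [apply exp_pos|]. apply G_pos; lra. }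
    lra.
  - assert (x1t : x1 lam = - t).
    { apply iota_spec.
      - rewrite e, Ropp_involutive. lra.
      - intros x [hx ex]. rewrite e in ex.
        destruct (Rtotal_order (- x) t) as [h|[h|h]]; [|lra|].
        + specialize (hlt (- x)). lra.
        + specialize (hgt (- x) h). lra. }
    rewrite x1t. repeat split.
    + lra.
    + now rewrite e, Ropp_involutive.
    + intros x hx. rewrite e. apply hgt. lra.
    + intros x hx. rewrite e. apply hlt. lra.
Qed.

(** The even solution: the middle branch of [H] is [psi (x / sigma)], and [z] is the positive
    inflection point of [psi]. *)
Definition psi (lam x : R) : R := phi lam x + phi lam (- x).
Definition psi1 (lam x : R) : R := phi1 lam x - phi1 lam (- x).

Lemma psi_solves (lam : R) : lam < 1 / 2 -> solves lam (psi lam) (psi1 lam).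
Proof.
  intros hl x. assert (hs := phi_solves lam hl).
  destruct (solves_comb lam 1 1 _ _ _ _ hs (solves_opp _ _ _ hs) x) as [h1 h2].
  split.
  - assert (e : 1 * phi1 lam x + 1 * - phi1 lam (- x) = psi1 lam x) by (unfold psi1; ring).
    rewrite <- e. apply is_derive_ext with (2 := h1). intros y. unfold psi. simpl. ring.
  - assert (e : second lam (fun x => 1 * phi lam x + 1 * phi lam (- x))
         (fun x => 1 * phi1 lam x + 1 * - phi1 lam (- x)) x = second lam (psi lam) (psi1 lam) x)
      by (unfold second, psi, psi1; ring).
    rewrite <- e. apply is_derive_ext with (2 := h2). intros y. unfold psi1. simpl. ring.
Qed.

Lemma psi_pos (lam x : R) : lam < 1 / 2 -> 0 < psi lam x.
Proof. intros hl. apply Rplus_lt_0_compat; now apply phi_pos. Qed.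

Lemma psi1_0 (lam : R) : psi1 lam 0 = 0.
Proof. unfold psi1. rewrite Ropp_0. ring. Qed.

Lemma psi_second (lam x : R) : lam < 1 / 2 ->
  second lam (psi lam) (psi1 lam) x = phi'' lam x + phi'' lam (- x).
Proof.
  intros hl. rewrite !phi''_second by exact hl. unfold second, psi, psi1. ring.
Qed.

Lemma z_spec (lam : R) : 0 < lam < 1 / 2 ->
  0 < z lam /\ second lam (psi lam) (psi1 lam) (z lam) = 0 /\
  (forall x, 0 < x < z lam -> second lam (psi lam) (psi1 lam) x < 0) /\
  (forall x, z lam < x -> 0 < second lam (psi lam) (psi1 lam) x).
Proof.
  intros [l0 l1].
  destruct (inflection lam (psi lam) (psi1 lam)) as (t & t0 & ht & hlt & hgt).
  - exact l0.
  - now apply psi_solves.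
  - intros x _. now apply psi_pos.
  - rewrite psi1_0. lra.
  - assert (zt : z lam = t).
    { apply iota_spec.
      - now rewrite <- psi_second.
      - intros x [hx ex]. rewrite <- psi_second in ex by exact l1.
        destruct (Rtotal_order x t) as [h|[h|h]]; [|exact h|].
        + specialize (hlt x). lra.
        + specialize (hgt x h). lra. }
    rewrite zt. auto.
Qed.

(** At [t = x1 mu < 0] one has [- t phi_mu'/phi_mu = 2 mu]. Were [x1 lam < t], then
    [- t phi_lam'/phi_lam < 2 lam]. But [phi'/phi] is [G(a+1)/G(a) - t] with [a = - 2 lam],
    respectively [- 2 mu], so [G_ratio_mono] gives [phi_mu'/phi_mu <= phi_lam'/phi_lam], hence
    [mu < lam]. *)
Lemma x1_anti (lam mu : R) : 0 < lam <= mu -> mu < 1 / 2 -> x1 mu <= x1 lam.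
Proof.
  intros [l0 hlm] hm.
  destruct (x1_spec lam) as (_ & _ & _ & hneg); [lra|].
  destruct (x1_spec mu) as (xm & em & _ & _); [lra|].
  rewrite phi''_second in em by exact hm.
  apply Rnot_lt_le. intros h.
  specialize (hneg (x1 mu)). rewrite phi''_second in hneg by lra.
  set (t := x1 mu) in *.
  unfold second in *.
  rewrite phi_G in hneg, em by lra.
  assert (hr := G_ratio_mono (- (2 * lam)) (- (2 * mu)) t ltac:(lra)).
  assert (pm := G_pos (- (2 * mu)) t ltac:(lra)).
  assert (pl := G_pos (- (2 * lam)) t ltac:(lra)).
  unfold phi1 in *.
  set (E := exp (- (t ^ 2 / 2))) in *.
  assert (hE : 0 < E) by apply exp_pos.
  set (a := G (- (2 * lam)) t) in *. set (a1 := G (- (2 * lam) + 1) t) in *.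
  set (b := G (- (2 * mu)) t) in *. set (b1 := G (- (2 * mu) + 1) t) in *.
  assert (em' : - t * (b1 - t * b) = 2 * mu * b).
  { apply Rmult_eq_reg_l with E; [|lra]. lra. }
  assert (h1 : - t * (a1 - t * a) < 2 * lam * a).
  { apply Rmult_lt_reg_l with E; [exact hE|]. lra. }
  assert (h2 : - t * (b1 * a) <= - t * (a1 * b)) by (apply Rmult_le_compat_l; lra).
  assert (h3 : - t * (a1 - t * a) * b < 2 * lam * a * b) by (apply Rmult_lt_compat_r; lra).
  assert (h4 : - t * (b1 - t * b) * a = 2 * mu * b * a) by now rewrite em'.
  assert (0 <= (mu - lam) * (a * b)) by (apply Rmult_le_pos; nra).
  lra.
Qed.

(** At [t = z mu] one has [- t psi_mu'/psi_mu = 2 mu]. Were [z lam < t], then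
    [- t psi_lam'/psi_lam > 2 lam]. Multiplied by [lam] and [mu] respectively, these contradict
    [log_derivative_mono]. *)
Lemma z_anti (lam mu : R) : 0 < lam <= mu -> mu < 1 / 2 -> z mu <= z lam.
Proof.
  intros [l0 hlm] hm.
  destruct (z_spec lam) as (_ & _ & _ & hpos); [lra|].
  destruct (z_spec mu) as (z0 & ez & _ & _); [lra|].
  apply Rnot_lt_le. intros h. specialize (hpos _ h).
  set (t := z mu) in *.
  assert (hw := log_derivative_mono lam mu t (psi lam) (psi1 lam) (psi mu) (psi1 mu)
    (conj l0 hlm) (psi_solves lam ltac:(lra)) (psi_solves mu hm)
    (fun x _ => psi_pos lam x ltac:(lra)) (fun x _ => psi_pos mu x hm)
    (psi1_0 lam) (psi1_0 mu) z0).
  assert (pm := psi_pos mu t hm). assert (pl := psi_pos lam t ltac:(lra)).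
  unfold second in *.
  assert (h1 : t * (lam * (psi1 mu t * psi lam t)) <= t * (mu * (psi1 lam t * psi mu t)))
    by (apply Rmult_le_compat_l; lra).
  assert (h2 : 0 < mu * psi mu t * (- t * psi1 lam t - 2 * lam * psi lam t)).
  { apply Rmult_lt_0_compat; [|exact hpos]. apply Rmult_lt_0_compat; lra. }
  assert (h3 : lam * psi lam t * (- t * psi1 mu t - 2 * mu * psi mu t) = 0) by (rewrite ez; ring).
  lra.
Qed.

(** * Gluing the branches *)

Lemma C2_intro (f f1 f2 : R -> R) :
  (forall x, is_derive f x (f1 x)) -> (forall x, is_derive f1 x (f2 x)) ->
  (forall x, continuous f2 x) -> C2 f.
Proof.
  intros h1 h2 hc. split.
  - intros [|[|[|k]]] x hk; simpl.
    + exact I.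
    + eexists. apply h1.
    + exists (f2 x). apply is_derive_ext with f1; [|apply h2].
      intros y. symmetry. apply is_derive_unique, h1.
    + lia.
  - intros x. apply continuous_ext with f2; [|apply hc].
    intros y. symmetry. now apply Derive_2 with f1.
Qed.

Definition glue (c : R) (f g : R -> R) (x : R) : R := if Rle_dec x c then f x else g x.

Lemma glue_left (c : R) (f g : R -> R) (x : R) : x <= c -> glue c f g x = f x.
Proof. intros h. unfold glue. now destruct (Rle_dec x c). Qed.

Lemma glue_right (c : R) (f g : R -> R) (x : R) : f c = g c -> c <= x -> glue c f g x = g x.
Proof.
  intros e h. unfold glue. destruct (Rle_dec x c); [|reflexivity].
  now replace x with c by lra.
Qed.

Lemma locally_lt (c x : R) : x < c -> locally x (fun y => y < c).
Proof. intros h. exact (open_lt c x h). Qed.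

Lemma locally_gt (c x : R) : c < x -> locally x (fun y => c < y).
Proof. intros h. exact (open_gt c x h). Qed.

Lemma glue_continuous (c : R) (f g : R -> R) (x : R) : f c = g c ->
  (forall x, continuous f x) -> (forall x, continuous g x) -> continuous (glue c f g) x.
Proof.
  intros e hf hg. destruct (Rtotal_order x c) as [h|[h|h]].
  - apply continuous_ext_loc with f; [|apply hf].
    apply filter_imp with (2 := locally_lt c x h).
    intros y hy. symmetry. apply glue_left. now apply Rlt_le.
  - subst x. intros P. rewrite (glue_left c f g c (Rle_refl c)). intros hP.
    assert (hf' := hf c P hP). rewrite e in hP. assert (hg' := hg c P hP).
    unfold filtermap in *.
    refine (filter_imp _ _ _ (filter_and _ _ hf' hg')).
    intros y [h1 h2]. unfold glue. now destruct (Rle_dec y c).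
  - apply continuous_ext_loc with g; [|apply hg].
    apply filter_imp with (2 := locally_gt c x h).
    intros y hy. symmetry. apply glue_right; [exact e|]. now apply Rlt_le.
Qed.

(** At [c] each difference quotient is one of [f] or one of [g], according to the sign of the
    increment, and both have the same limit. *)
Lemma glue_derive (c : R) (f f1 g g1 : R -> R) (x : R) : f c = g c -> f1 c = g1 c ->
  (forall x, is_derive f x (f1 x)) -> (forall x, is_derive g x (g1 x)) ->
  is_derive (glue c f g) x (glue c f1 g1 x).
Proof.
  intros e e1 hf hg. destruct (Rtotal_order x c) as [h|[h|h]].
  - rewrite glue_left by lra. apply is_derive_ext_loc with f; [|apply hf].
    apply filter_imp with (2 := locally_lt c x h).
    intros y hy. symmetry. apply glue_left. now apply Rlt_le.
  - subst x. rewrite glue_left by lra. apply is_derive_Reals.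
    intros eps heps.
    assert (df := hf c). apply is_derive_Reals in df. destruct (df eps heps) as [d1 hd1].
    assert (dg := hg c). apply is_derive_Reals in dg. destruct (dg eps heps) as [d2 hd2].
    assert (hd : 0 < Rmin d1 d2) by (apply Rmin_glb_lt; [apply d1|apply d2]).
    exists (mkposreal _ hd). simpl. intros h h0 hh.
    rewrite (glue_left c f g c) by lra.
    destruct (Rle_dec (c + h) c) as [hc|hc].
    + rewrite glue_left by exact hc. apply hd1; [exact h0|].
      eapply Rlt_le_trans; [exact hh|apply Rmin_l].
    + rewrite glue_right by lra. rewrite e, e1. apply hd2; [exact h0|].
      eapply Rlt_le_trans; [exact hh|apply Rmin_r].
  - rewrite glue_right by lra. apply is_derive_ext_loc with g; [|apply hg].
    apply filter_imp with (2 := locally_gt c x h).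
    intros y hy. symmetry. apply glue_right; [exact e|]. now apply Rlt_le.
Qed.

Lemma is_derive_scale (f : R -> R) (s x l : R) : s <> 0 ->
  is_derive f (x / s) l -> is_derive (fun x => f (x / s)) x (l / s).
Proof.
  intros hs h. unfold Rdiv in *. auto_derive; [now exists l|].
  rewrite (Derive_eta _ _ _ h). field. exact hs.
Qed.

Lemma second_continuous (lam : R) (f f1 : R -> R) (x : R) :
  solves lam f f1 -> continuous (second lam f f1) x.
Proof.
  intros h. apply (ex_derive_continuous (V := R_NormedModule)). eexists.
  now apply second_derive.
Qed.

(** Write [s = sigma z]. Since [- s <= x1], [phi''(-s) >= 0]. If [phi''(s) >= 0] held, [second_pos]
    would give [phi''(z) > 0], while [phi''(-z) > 0] and their sum is 0; so [phi''(s) < 0]. These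
    signs fix those of the coefficients, which solve the linear system of the two equalities:
    matching value and vanishing second derivative at [s]. *)
Lemma mu_signs (lam sigma : R) : 0 < lam < 1 / 2 -> 0 < sigma < 1 ->
  - x1 lam <= sigma * z lam -> 0 < mu1 lam sigma /\ 0 <= mu2 lam sigma /\
  mu2 lam sigma * phi lam (sigma * z lam) + mu1 lam sigma * phi lam (- (sigma * z lam))
    = psi lam (z lam) /\
  mu2 lam sigma * phi'' lam (sigma * z lam) + mu1 lam sigma * phi'' lam (- (sigma * z lam)) = 0.
Proof.
  intros hl hs hx.
  destruct (z_spec lam hl) as (z0 & ez & _ & _).
  destruct (x1_spec lam hl) as (x0 & ex & hpos & _).
  rewrite psi_second in ez by lra.
  assert (sz : sigma * z lam < z lam) by nra.
  assert (s0 : 0 < sigma * z lam) by (apply Rmult_lt_0_compat; lra).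
  assert (pz : 0 < phi'' lam (- z lam)) by (apply hpos; lra).
  assert (ns : phi'' lam (sigma * z lam) < 0).
  { apply Rnot_le_lt. intros h. rewrite phi''_second in h by lra.
    assert (h2 := second_pos lam (phi lam) (phi1 lam) (sigma * z lam) (proj1 hl)
      (phi_solves lam (proj2 hl)) s0 (fun x _ => phi_pos lam x (proj2 hl)) h (z lam) sz).
    rewrite <- phi''_second in h2 by lra. lra. }
  assert (ps : 0 <= phi'' lam (- (sigma * z lam))).
  { destruct (Req_dec (- (sigma * z lam)) (x1 lam)) as [e|e].
    - rewrite e, ex. lra.
    - apply Rlt_le, hpos. lra. }
  unfold mu1, mu2. cbv zeta.
  assert (pp := psi_pos lam (z lam) (proj2 hl)).
  replace (phi lam (- z lam) + phi lam (z lam)) with (psi lam (z lam)) by (unfold psi; ring).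
  assert (pa := phi_pos lam (sigma * z lam) (proj2 hl)).
  assert (pb := phi_pos lam (- (sigma * z lam)) (proj2 hl)).
  set (a := phi lam (sigma * z lam)) in *. set (b := phi lam (- (sigma * z lam))) in *.
  set (a2 := phi'' lam (sigma * z lam)) in *. set (b2 := phi'' lam (- (sigma * z lam))) in *.
  set (w := psi lam (z lam)) in *.
  assert (d1 : 0 < b * - a2 + a * b2).
  { apply Rplus_lt_le_0_compat; [apply Rmult_lt_0_compat|apply Rmult_le_pos]; lra. }
  repeat split.
  - replace (a2 * w / (b * a2 - a * b2)) with (- a2 * w / (b * - a2 + a * b2)) by (field; lra).
    apply Rdiv_lt_0_compat; [apply Rmult_lt_0_compat|]; lra.
  - replace (a * b2 - b * a2) with (b * - a2 + a * b2) by ring.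
    apply Rdiv_le_0_compat; [apply Rmult_le_pos|]; lra.
  - field. lra.
  - field. lra.
Qed.

Theorem theorem3p15 (sigma : R) (hsigma : 0 < sigma < 1)
  (lambda_sigma : R) (hls : 0 < lambda_sigma < 1 / 2)
  (hls_eq : sigma_ lambda_sigma = sigma)
  (lam : R) (hlam : 0 < lam <= lambda_sigma) :
  (forall x : R, 0 < H lam sigma x) /\
  C2 (H lam sigma) /\
  (forall x : R,
     pos_part (Derive_n (H lam sigma) 2 x)
     - sigma ^ 2 * neg_part (Derive_n (H lam sigma) 2 x)
     + x * Derive (H lam sigma) x
     + 2 * lam * H lam sigma x = 0).
Proof.
  assert (hl : 0 < lam < 1 / 2) by lra.
  assert (zl := z_anti lam lambda_sigma hlam (proj2 hls)).
  assert (xl := x1_anti lam lambda_sigma hlam (proj2 hls)).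
  destruct (z_spec lam hl) as (z0 & ez & zneg & _).
  destruct (z_spec lambda_sigma hls) as (zs0 & _).
  (* The inequality [sigma_ lam <= sigma] without division: [- x1 lam <= - x1 lambda_sigma = sigma *
     z lambda_sigma <= sigma * z lam]. *)
  assert (hx : - x1 lam <= sigma * z lam).
  { assert (e : sigma * z lambda_sigma = - x1 lambda_sigma)
      by (rewrite <- hls_eq; unfold sigma_; field; lra).
    nra. }
  destruct (mu_signs lam sigma hl hsigma hx) as (m1 & m2 & eC & eC2).
  set (s := sigma * z lam) in *.
  assert (s0 : 0 < s) by (apply Rmult_lt_0_compat; lra).
  set (n1 := mu1 lam sigma) in *. set (n2 := mu2 lam sigma) in *.
  (* [C] is the right outer branch, [B] the middle one, and [A], the reflection of [C], the left
     one; suffixes 1 and 2 mark derivatives. *)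
  set (C := fun x => n2 * phi lam x + n1 * phi lam (- x)).
  set (C1 := fun x => n2 * phi1 lam x + n1 * - phi1 lam (- x)).
  set (B := fun x => psi lam (x / sigma)).
  set (B1 := fun x => psi1 lam (x / sigma) / sigma).
  set (B2 := fun x => second lam (psi lam) (psi1 lam) (x / sigma) / sigma / sigma).
  set (A := fun x => C (- x)).
  set (A1 := fun x => - C1 (- x)).
  assert (solC : solves lam C C1)
    by (apply solves_comb; [|apply solves_opp]; apply phi_solves, hl).
  assert (solA : solves lam A A1) by (apply solves_opp, solC).
  assert (dB : forall x, is_derive B x (B1 x)).
  { intros x. apply is_derive_scale; [lra|]. now apply psi_solves. }
  assert (dB1 : forall x, is_derive B1 x (B2 x)).
  { intros x. unfold B1, B2.
    apply (is_derive_ext (fun x => / sigma * psi1 lam (x / sigma))).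
    { intros y. unfold Rdiv. apply Rmult_comm. }
    unfold Rdiv at 2. rewrite Rmult_comm. apply (is_derive_scal (fun y => psi1 lam (y / sigma))).
    apply is_derive_scale; [lra|]. now apply psi_solves. }
  assert (zs : s / sigma = z lam) by (unfold s; field; lra).
  assert (nzs : - s / sigma = - z lam) by (unfold s; field; lra).
  (* Parity of [B] and its derivatives carries the matching at [s] over to [- s]. *)
  assert (B2even : forall x, B2 (- x) = B2 x).
  { intros x. unfold B2. rewrite !psi_second by lra.
    replace (- x / sigma) with (- (x / sigma)) by (field; lra).
    rewrite Ropp_involutive. f_equal. f_equal. ring. }
  assert (Beven : forall x, B (- x) = B x).
  { intros x. unfold B, psi.
    replace (- x / sigma) with (- (x / sigma)) by (field; lra).
    rewrite Ropp_involutive. ring. }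
  assert (B1odd : forall x, B1 (- x) = - B1 x).
  { intros x. unfold B1, psi1.
    replace (- x / sigma) with (- (x / sigma)) by (field; lra).
    rewrite Ropp_involutive. field. lra. }
  assert (A2 : forall x, second lam A A1 x = second lam C C1 (- x)).
  { intros x. unfold second, A, A1. ring. }
  assert (odeB : forall x, sigma ^ 2 * B2 x + x * B1 x + 2 * lam * B x = 0).
  { intros x. unfold B2, B1, B, second. field. lra. }
  assert (j0 : B s = C s) by (unfold B; rewrite zs; symmetry; exact eC).
  assert (jB2 : B2 s = 0) by (unfold B2; rewrite zs, ez; unfold Rdiv; ring).
  assert (jC2 : second lam C C1 s = 0).
  { rewrite <- eC2, !phi''_second by lra. unfold second, C, C1. ring. }
  assert (j1 : B1 s = C1 s).
  { apply Rmult_eq_reg_l with s; [|lra].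
    generalize (odeB s). rewrite jB2. generalize jC2. unfold second. rewrite j0. lra. }
  set (K := glue s B C). set (K1 := glue s B1 C1). set (K2 := glue s B2 (second lam C C1)).
  assert (lK : forall f g, glue s f g (- s) = f (- s)) by (intros; apply glue_left; lra).
  assert (i0 : A (- s) = K (- s)).
  { unfold K. rewrite lK, Beven, j0. unfold A. now rewrite Ropp_involutive. }
  assert (i1 : A1 (- s) = K1 (- s)).
  { unfold K1. rewrite lK, B1odd, j1. unfold A1. now rewrite Ropp_involutive. }
  assert (i2 : second lam A A1 (- s) = K2 (- s)).
  { unfold K2. rewrite lK, B2even, jB2, A2, Ropp_involutive. exact jC2. }
  set (L := glue (- s) A K). set (L1 := glue (- s) A1 K1).
  set (L2 := glue (- s) (second lam A A1) K2).
  assert (HL : forall x, L x = H lam sigma x).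
  { intros x. unfold H. fold s n1 n2. unfold L, glue at 1.
    destruct (Rle_dec x (- s)) as [h|h].
    - unfold A, C. rewrite Ropp_involutive. ring.
    - unfold K. destruct (Rlt_dec x s) as [h'|h'].
      + rewrite glue_left by lra. reflexivity.
      (* At [x = s] itself [H] takes the outer branch and [glue] the middle one; [j0] makes them
         equal. *)
      + rewrite glue_right by (trivial; lra). reflexivity. }
  assert (dH : forall x, is_derive (H lam sigma) x (L1 x)).
  { intros x. apply (is_derive_ext L); [exact HL|].
    apply glue_derive; trivial; intros y; [apply solA|].
    apply glue_derive; trivial. intros w. apply solC. }
  assert (dL1 : forall x, is_derive L1 x (L2 x)).
  { intros x. apply glue_derive; trivial; intros y; [apply solA|].
    apply glue_derive; trivial; [now rewrite jB2, jC2|]. intros w. apply solC. }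
  assert (cL2 : forall x, continuous L2 x).
  { intros x. apply glue_continuous; trivial; intros y; [now apply second_continuous|].
    apply glue_continuous; [now rewrite jB2, jC2| |]; intros w.
    - unfold B2. apply (continuous_ext
        (fun x => scal (/ sigma / sigma) (second lam (psi lam) (psi1 lam) (x / sigma)))).
      { intros v. unfold scal; simpl; unfold mult; simpl. field. lra. }
      apply (continuous_scal_r (V := R_NormedModule)).
      apply (continuous_comp (fun x => x / sigma) (second lam (psi lam) (psi1 lam))).
      + apply (ex_derive_continuous (V := R_NormedModule)). auto_derive. lra.
      + now apply second_continuous, psi_solves.
    - now apply second_continuous. }
  assert (pC : forall x, 0 < C x).
  { intros x. unfold C. assert (p1 := phi_pos lam x (proj2 hl)).
    assert (p2 := phi_pos lam (- x) (proj2 hl)).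
    assert (0 < n1 * phi lam (- x)) by now apply Rmult_lt_0_compat.
    assert (0 <= n2 * phi lam x) by (apply Rmult_le_pos; lra). lra. }
  assert (cC : forall x, s <= x -> 0 <= second lam C C1 x).
  { intros x [h|h].
    - apply Rlt_le, (second_pos lam C C1 s); trivial; lra.
    - rewrite <- h, jC2. lra. }
  assert (cB : forall x, - s <= x <= s -> B2 x <= 0).
  { assert (half : forall x, 0 <= x <= s -> B2 x <= 0).
    { intros x [h1 h2]. unfold B2.
      assert (hh : second lam (psi lam) (psi1 lam) (x / sigma) <= 0).
      { destruct h1 as [h1|h1].
        - destruct h2 as [h2|h2].
          + apply Rlt_le, zneg. split; [apply Rdiv_lt_0_compat; lra|].
            rewrite <- zs. apply Rmult_lt_compat_r; [apply Rinv_0_lt_compat|]; lra.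
          + rewrite h2, zs, ez. lra.
        (* The sign from [z_spec] starts strictly after 0; at 0 the value is [- 2 lam psi(0)]. *)
        - rewrite <- h1. unfold Rdiv. rewrite Rmult_0_l. unfold second.
          assert (0 < lam * psi lam 0) by (apply Rmult_lt_0_compat; [|apply psi_pos]; lra).
          lra. }
      assert (hi : 0 < / sigma) by (apply Rinv_0_lt_compat; lra).
      unfold Rdiv at 1 2. rewrite Rmult_assoc.
      assert (0 < / sigma * / sigma) by now apply Rmult_lt_0_compat. nra. }
    intros x hx'. destruct (Rle_dec 0 x); [apply half; lra|].
    rewrite <- B2even. apply half. lra. }
  split; [|split].
  - intros x. rewrite <- HL. unfold L, K, glue.
    destruct (Rle_dec x (- s)); [apply pC|].
    destruct (Rle_dec x s); [unfold B; apply psi_pos, hl|apply pC].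
  - now apply C2_intro with L1 L2.
  - intros x. rewrite (Derive_2 _ L1 L2 x dH dL1).
    replace (Derive (H lam sigma) x) with (L1 x) by (symmetry; apply is_derive_unique, dH).
    rewrite <- HL. unfold L, L1, L2, K, K1, K2, glue, neg_part, pos_part.
    (* On the convex outer pieces the nonlinear terms reduce to [y''], on the concave middle piece
       to [sigma^2 y'']; each is the linear equation of its branch. *)
    destruct (Rle_dec x (- s)) as [h|h]; [|destruct (Rle_dec x s) as [h'|h']].
    + assert (0 <= second lam A A1 x) by (rewrite A2; apply cC; lra).
      rewrite Rmax_right, Rmax_left by lra. unfold second. ring.
    + assert (B2 x <= 0) by (apply cB; lra).
      rewrite Rmax_left, Rmax_right by lra. generalize (odeB x). lra.
    + assert (0 <= second lam C C1 x) by (apply cC; lra).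
      rewrite Rmax_right, Rmax_left by lra. unfold second. ring.
Qed.
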